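(* Let $R$ be a noetherian domain, $\mathfrak{a}\subset R$ a nonzero ideal, and $t\in\mathbb{R}_{>0}$. Then $\overline{R}^{\mathfrak{a}^t}$ is an $R$-submodule of $\operatorname{Frac}(R)$. Furthermore, when $R$ has prime characteristic $p>0$ and the $\mathfrak{a}^t$-test ideal of $R$ is nonzero, $\overline{R}^{\mathfrak{a}^t}$ is a fractional ideal of $R$.
   Context: All rings are commutative with unit and noetherian. $R^\circ=R\setminus\{0\}$ for a domain $R$. For an ideal $I$, $$\overline{I}^{\mathfrak{a}^t}=\{x\in R\mid\text{for some }c\in R^\circ\text{ and all }n\gg0,\ cx^n\mathfrak{a}^{\lceil tn\rceil}\subset I^n\}.$$ The $\mathfrak{a}^t$-normalization of $R$ is $$\overline{R}^{\mathfrak{a}^t}=\{r/s\in\operatorname{Frac}(R)\mid r\in\overline{(s)}^{\mathfrak{a}^t}\}$$ (membership does not depend on the representation of the fraction). An $R$-submodule $I$ of $\operatorname{Frac}(R)$ is a fractional ideal if there is a nonzero $r\in R$ with $rI\subset R$. In characteristic $p>0$, $I^{[p^e]}$ is the ideal generated by $\{r^{p^e}\mid r\in I\}$ and $I^{*\mathfrak{a}^t}=\{x\in R\mid\text{for some }c\in R^\circ\text{ and all }e\gg0,\ cx^{p^e}\mathfrak{a}^{\lceil tp^e\rceil}\subset I^{[p^e]}\}$. The $\mathfrak{a}^t$-test ideal of $R$ is the ideal generated by the $\mathfrak{a}^t$-test elements, i.e. the elements $c\in R^\circ$ such that for all ideals $I\subset R$, all $x\in I^{*\mathfrak{a}^t}$,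 and all $e\ge0$, $cx^{p^e}\mathfrak{a}^{\lceil tp^e\rceil}\subset I^{[p^e]}$. *)

(* Defs.v *)
From HB Require Import structures.
From mathcomp Require Import all_boot all_order all_algebra.
From mathcomp Require Import boolp classical_sets filter reals.

Set Implicit Arguments.
Unset Strict Implicit.
Unset Printing Implicit Defensive.

Import Order.TTheory GRing.Theory Num.Theory.

Local Open Scope classical_set_scope.
Local Open Scope ring_scope.

(* Ideals are Prop-valued sets, so that no decidability is assumed; the unit
   ideal is allowed, unlike in MathComp's ring_quotient, whose ideals are proper
   and boolean. *)
Section Ideals.
Variable R : comNzRingType.
Implicit Types (I J S : set R).

Definition is_ideal I : Prop :=
  [/\ I 0, forall x y, I x -> I y -> I (x + y) & forall r x, I x -> I (r * x)].

Definition ideal_gen S : set R := smallest is_ideal S.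

Definition noetherian : Prop :=
  forall I, is_ideal I -> exists s : seq R, I = ideal_gen [set x | x \in s].

Definition ideal_mul I J : set R := ideal_gen [set x * y | x in I & y in J].

(* I^0 is the unit ideal *)
Definition ideal_pow I (n : nat) : set R := iter n (ideal_mul I) [set: R].

(* I^{[q]}, used with q = p ^ e *)
Definition frob_pow I (q : nat) : set R := ideal_gen [set r ^+ q | r in I].

End Ideals.

(* The natural number ceil (t * n); the absolute value only casts from int and
   is harmless since t >= 0 wherever this is used. *)
Definition ceil_mul (K : realType) (t : K) (n : nat) : nat :=
  `|Num.ceil (t * n%:R)|%N.

Section Closures.
Variables (K : realType) (R : idomainType).
Implicit Types (a I : set R) (t : K).

Definition at_closure a t I : set R :=
  [set x | exists2 c : R, c != 0 &
    \forall n \near \oo, forall y, ideal_pow a (ceil_mul t n) y ->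
      ideal_pow I n (c * x ^+ n * y)].

Definition at_normalization a t : set {fraction R} :=
  [set f | exists r s : R,
    [/\ s != 0, f = tofrac r / tofrac s & at_closure a t (ideal_gen [set s]) r]].

Definition at_tight_closure (p : nat) a t I : set R :=
  [set x | exists2 c : R, c != 0 &
    \forall e \near \oo, forall y, ideal_pow a (ceil_mul t (p ^ e)) y ->
      frob_pow I (p ^ e) (c * x ^+ (p ^ e) * y)].

Definition at_test_element (p : nat) a t (c : R) : Prop :=
  c != 0 /\
  forall I, is_ideal I -> forall x, at_tight_closure p a t I x ->
    forall (e : nat) y, ideal_pow a (ceil_mul t (p ^ e)) y ->
      frob_pow I (p ^ e) (c * x ^+ (p ^ e) * y).

Definition at_test_ideal (p : nat) a t : set R :=
  ideal_gen (at_test_element p a t).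

Definition is_frac_submodule (M : set {fraction R}) : Prop :=
  [/\ M 0, forall f g, M f -> M g -> M (f + g)
    & forall (r : R) f, M f -> M (tofrac r * f)].

Definition is_fractional_ideal (M : set {fraction R}) : Prop :=
  is_frac_submodule M /\
  exists2 r : R, r != 0 &
    forall f, M f -> exists x : R, tofrac r * f = tofrac x.

End Closures.

(* Main.v *)
Require Import Defs.
From mathcomp Require Import all_boot all_order all_algebra.
From mathcomp Require Import boolp classical_sets filter reals.
From mathcomp Require Import ring lra.

(** Write [f = r / s].  Since the powers of a principal ideal [(s)] are the
    principal ideals [(s ^ n)], membership of [f] in the normalization says that
    one nonzero [c] satisfies [c f ^ n a ^ ceil (t n) <= R] for large [n].
    Multiplying [c] by a suitable power of [s] clears the denominators of the
    finitely many remaining powers of [f], so that the inclusion may be required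
    for all [n] ([at_closure_principalP]).

    This uniform form makes sums tractable.  If [c] works for [f] and [d] for
    [g], expand [(f + g) ^ n] by the binomial formula.  The term in
    [f ^ i g ^ j], with [i + j = n], needs [a ^ (ceil (t i) + ceil (t j))], and
    rounding costs at most one: [ceil (t i) + ceil (t j) <= ceil (t n) + 1]
    ([ceil_mul_addn]).  One further factor [b] in [a], nonzero, makes up for that,
    so [c d b] works for [f + g] ([at_closure_add]).

    In characteristic [p], restricting to the exponents [n = p ^ e] shows that
    [r] lies in the tight closure of [(s)], because ordinary and Frobenius powers
    of a principal ideal agree ([at_closure_tight]).  A test element [c], used
    with [e = 0], then gives [c r a ^ ceil t <= (s)]; hence [c b ^ ceil t] is a
    common denominator for the whole normalization. *)

Import Order.TTheory GRing.Theory Num.Theory.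

Local Open Scope classical_set_scope.
Local Open Scope ring_scope.

(** * Generated ideals and powers of ideals *)

Section IdealPowers.
Variable R : comNzRingType.
Implicit Types (I J S P : set R).

Lemma ideal_gen_ideal S : is_ideal (ideal_gen S).
Proof.
split=> [I [[]]//|x y Sx Sy I IS|r x Sx I IS].
- by have [[_ ID _] _] := IS; apply: ID; [exact: Sx|exact: Sy].
- by have [[_ _ IM] _] := IS; apply: IM; exact: Sx.
Qed.

Lemma sub_ideal_gen S : S `<=` ideal_gen S.
Proof. by move=> x Sx I [_]; apply. Qed.

Lemma ideal_gen_min S P : is_ideal P -> S `<=` P -> ideal_gen S `<=` P.
Proof. by move=> iP SP x; apply. Qed.

Lemma ideal_pow_ideal I n : is_ideal (ideal_pow I n).
Proof. by case: n => [|n]; [split|exact: ideal_gen_ideal]. Qed.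

Lemma mem_ideal_powS I n x y :
  I x -> ideal_pow I n y -> ideal_pow I n.+1 (x * y).
Proof. by move=> Ix Iy; apply: sub_ideal_gen; exists x => //; exists y. Qed.

Lemma mem_ideal_pow I n x : I x -> ideal_pow I n (x ^+ n).
Proof. by move=> Ix; elim: n => // n IHn; rewrite exprS; exact: mem_ideal_powS. Qed.

Lemma ideal_powS_sub I n : ideal_pow I n.+1 `<=` ideal_pow I n.
Proof.
have [_ _ IM] := ideal_pow_ideal I n.
apply: ideal_gen_min; first exact: ideal_pow_ideal.
by move=> _ [x _ [y Iy <-]]; exact: IM.
Qed.

Lemma ideal_pow_leq I m n : (m <= n)%N -> ideal_pow I n `<=` ideal_pow I m.
Proof.
move=> /subnK <-; elim: (n - m)%N => // k IHk x.
by move/ideal_powS_sub; exact: IHk.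
Qed.

Lemma colon_ideal P x : is_ideal P -> is_ideal [set y | P (x * y)].
Proof.
case=> P0 PD PM; split=> /= [|y z Py Pz|r y Py].
- by rewrite mulr0.
- by rewrite mulrDr; exact: PD.
- by rewrite mulrCA; exact: PM.
Qed.

(** The inclusion of [I ^ (m + n)] in [I ^ m I ^ n], as an elimination rule: the
    nested definition of powers only peels off one factor at a time. *)
Lemma ideal_powD_ind I m n P : is_ideal P ->
  (forall u v, ideal_pow I m u -> ideal_pow I n v -> P (u * v)) ->
  ideal_pow I (m + n) `<=` P.
Proof.
elim: m P => [|m IHm] P iP Puv.
  by move=> v Iv; rewrite -[v]mul1r; exact: Puv.
apply: ideal_gen_min => // _ [x Ix [y Iy <-]].
apply: (IHm [set y | P (x * y)]) => //; first exact: colon_ideal.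
by move=> u v Iu Iv /=; rewrite mulrA; apply: Puv => //; exact: mem_ideal_powS.
Qed.

(** * Principal ideals *)

Definition multiples (s : R) : set R := [set x | exists z, x = z * s].

Lemma multiples_ideal s : is_ideal (multiples s).
Proof.
split=> [|x y [u ->] [v ->]|r x [u ->]].
- by exists 0; rewrite mul0r.
- by exists (u + v); rewrite mulrDl.
- by exists (r * u); rewrite mulrA.
Qed.

Lemma ideal_gen1 s : ideal_gen [set s] = multiples s.
Proof.
apply/seteqP; split.
  by apply: ideal_gen_min => [|_ ->]; [exact: multiples_ideal|exists 1; rewrite mul1r].
move=> _ [z ->]; have [_ _ IM] := ideal_gen_ideal [set s].
by apply: IM; exact: sub_ideal_gen.
Qed.

Lemma ideal_pow_multiples s n : ideal_pow (multiples s) n = multiples (s ^+ n).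
Proof.
apply/seteqP; split.
  elim: n => [x _|n IHn]; first by exists x; rewrite expr0 mulr1.
  apply: ideal_gen_min; first exact: multiples_ideal.
  move=> _ [_ [u ->] [y /IHn[v ->] <-]].
  by exists (u * v); rewrite exprS mulrACA.
move=> _ [z ->]; have [_ _ IM] := ideal_pow_ideal (multiples s) n.
by apply: IM; apply: mem_ideal_pow; exists 1; rewrite mul1r.
Qed.

Lemma frob_pow_multiples s q : frob_pow (multiples s) q = multiples (s ^+ q).
Proof.
apply/seteqP; split.
  apply: ideal_gen_min => [|_ [_ [z ->] <-]]; first exact: multiples_ideal.
  by exists (z ^+ q); rewrite exprMn.
move=> _ [z ->].
have [_ _ IM] := ideal_gen_ideal [set r ^+ q | r in multiples s].
by apply: IM; apply: sub_ideal_gen; exists s => //; exists 1; rewrite mul1r.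
Qed.

Lemma ideal_gen_set0 : ideal_gen set0 = [set 0 : R].
Proof.
apply/seteqP; split=> [|_ ->]; last by case: (ideal_gen_ideal set0).
apply: ideal_gen_min => //; split=> //= [x y -> ->|r x ->].
  by rewrite addr0.
by rewrite mulr0.
Qed.

Lemma nonzero_mem_ideal I : is_ideal I -> I <> [set 0] -> exists2 b, I b & b != 0.
Proof.
move=> [I0 _ _] In0; apply: contrapT => noI; apply: In0.
apply/seteqP; split=> [x Ix|_ ->//] /=.
by apply: contrapT => /eqP x0; apply: noI; exists x.
Qed.

End IdealPowers.

(** * Rounding of exponents *)

Lemma ceil_mul_addn (K : realType) (t : K) i j : 0 <= t ->
  (ceil_mul t i + ceil_mul t j <= (ceil_mul t (i + j)).+1)%N.
Proof.
move=> t0.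
have abs_ceil n : (ceil_mul t n)%:Z = Num.ceil (t * n%:R).
  by rewrite /ceil_mul gez0_abs // ceil_ge0 (lt_le_trans (ltrN10 _)) ?mulr_ge0.
have lt_ceil n : (ceil_mul t n)%:R - 1 < t * n%:R.
  by rewrite -[_%:R]/((ceil_mul t n)%:Z%:~R) abs_ceil -(intrD _ _ (-1)) ceilB1_lt.
have ge_ceil n : t * n%:R <= (ceil_mul t n)%:R.
  by rewrite -[leRHS]/((ceil_mul t n)%:Z%:~R) abs_ceil ceil_ge.
rewrite -ltnS -(ltr_nat K) -addn2 !natrD.
have := ge_ceil (i + j)%N; rewrite natrD mulrDr.
by move: (lt_ceil i) (lt_ceil j); lra.
Qed.

(** * Closures of principal ideals *)

Section PrincipalClosures.
Variables (K : realType) (R : idomainType) (a : set R) (t : K).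
Implicit Types (c r s : R).

Definition uniform_multiplier r s c : Prop :=
  forall n y, ideal_pow a (ceil_mul t n) y ->
    multiples R (s ^+ n) (c * r ^+ n * y).

(** If [c] works for all [n >= N], then [c s ^ N] works for every [n]: below [N]
    the factor [s ^ N] alone is a multiple of [s ^ n]. *)
Lemma at_closure_principalP r s : s != 0 ->
  at_closure a t (ideal_gen [set s]) r <->
  exists2 c, c != 0 & uniform_multiplier r s c.
Proof.
move=> s0; rewrite ideal_gen1; split=> -[c c0 cP]; last first.
  exists c => //; exists 0%N => // n _ y ay.
  by rewrite ideal_pow_multiples; exact: cP.
case: cP => N _ cP; exists (c * s ^+ N) => [|n y ay].
  by rewrite mulf_neq0 // expf_neq0.
have [leNn|/ltnW lenN] := leqP N n.
  have := cP n leNn y ay; rewrite ideal_pow_multiples => -[z zE].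
  by exists (s ^+ N * z); rewrite -[RHS]mulrA -zE; ring.
by exists (c * s ^+ (N - n) * r ^+ n * y); rewrite -{1}(subnK lenN) exprD; ring.
Qed.

Lemma at_closure_zero s : s != 0 -> at_closure a t (ideal_gen [set s]) 0.
Proof.
move=> s0; apply/at_closure_principalP => //; exists 1; first exact: oner_neq0.
case=> [|n] y _; first by exists y; rewrite !expr0 !mul1r mulr1.
by exists 0; rewrite expr0n /= mulr0 !mul0r.
Qed.

Lemma at_closure_scale q r s : s != 0 ->
  at_closure a t (ideal_gen [set s]) r ->
  at_closure a t (ideal_gen [set s]) (q * r).
Proof.
move=> s0 /at_closure_principalP[//|c c0 cP].
apply/at_closure_principalP => //; exists c => // n y /cP[z zE].
by exists (q ^+ n * z); rewrite -[RHS]mulrA -zE exprMn; ring.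
Qed.

(** The numerator of [r1 / s1 + r2 / s2]; [b] absorbs the rounding error in the
    exponents of [a]. *)
Lemma at_closure_add b r1 s1 r2 s2 : 0 <= t -> a b -> b != 0 ->
  s1 != 0 -> s2 != 0 ->
  at_closure a t (ideal_gen [set s1]) r1 ->
  at_closure a t (ideal_gen [set s2]) r2 ->
  at_closure a t (ideal_gen [set s1 * s2]) (r1 * s2 + r2 * s1).
Proof.
move=> t0 ab b0 s10 s20 /at_closure_principalP[//|c c0 cP].
move=> /at_closure_principalP[//|d d0 dP].
apply/at_closure_principalP; first exact: mulf_neq0.
exists (c * d * b) => [|n y ay]; first by rewrite !mulf_neq0.
have [I0 ID IM] := multiples_ideal R ((s1 * s2) ^+ n).
rewrite exprDn mulr_sumr mulr_suml.
apply: big_ind => // i _; have lein : (i <= n)%N by rewrite -ltnS.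
(* Here [s2 ^ (n - i)] and [s1 ^ i] already come from the numerators. *)
have termP : ideal_pow a (ceil_mul t (n - i) + ceil_mul t i) `<=`
    [set w | multiples R (s1 ^+ (n - i) * s2 ^+ i)
      (c * d * r1 ^+ (n - i) * r2 ^+ i * w)].
  apply: ideal_powD_ind; first exact/colon_ideal/multiples_ideal.
  move=> u v /cP[z1 z1E] /dP[z2 z2E]; exists (z1 * z2).
  by rewrite [RHS]mulrACA -z1E -z2E; ring.
have aby : ideal_pow a (ceil_mul t (n - i) + ceil_mul t i) (b * y).
  apply: ideal_pow_leq (mem_ideal_powS _ _ _ _ _ ab ay).
  by have := ceil_mul_addn _ _ (n - i) i t0; rewrite subnK.
have [z zE] := termP _ aby.
exists (z *+ 'C(n, i)); rewrite mulrnAr mulrnAl mulrnAl; congr (_ *+ _).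
have sE s : s ^+ n = s ^+ (n - i) * s ^+ i by rewrite -exprD subnK.
transitivity (c * d * r1 ^+ (n - i) * r2 ^+ i * (b * y) *
  (s2 ^+ (n - i) * s1 ^+ i)); first by rewrite !exprMn; ring.
by rewrite zE exprMn !sE; ring.
Qed.

Lemma at_closure_tight p r s : (1 < p)%N ->
  at_closure a t (ideal_gen [set s]) r ->
  at_tight_closure p a t (ideal_gen [set s]) r.
Proof.
move=> p1 [c c0 [N _ cP]]; exists c => //; exists N => // e /= leNe y ay.
have := cP (p ^ e)%N (leq_trans leNe (ltnW (ltn_expl e p1))) y ay.
by rewrite ideal_gen1 ideal_pow_multiples frob_pow_multiples.
Qed.

Lemma at_test_element_principal p c r s y : at_test_element p a t c ->
  at_tight_closure p a t (ideal_gen [set s]) r ->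
  ideal_pow a (ceil_mul t 1) y -> multiples R s (c * y * r).
Proof.
move=> [_ cP] rP ay.
have := cP _ (ideal_gen_ideal _ _) r rP 0%N y.
rewrite expn0 ideal_gen1 frob_pow_multiples !expr1 mulrAC.
exact.
Qed.

End PrincipalClosures.

(** * The normalization *)

Theorem proposition5p2 (K : realType) (R : idomainType) (a : set R) (t : K) :
  noetherian R -> is_ideal a -> a <> [set 0] -> 0 < t ->
  is_frac_submodule (at_normalization a t) /\
  (forall p : nat, p \in [pchar R] -> at_test_ideal p a t <> [set 0] ->
    is_fractional_ideal (at_normalization a t)).
Proof.
move=> _ ia /(nonzero_mem_ideal _ _ ia)[b ab b0] t0.
have submod : is_frac_submodule (at_normalization a t).
  split.
  - exists 0, 1; split; first exact: oner_neq0.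
      by rewrite tofrac0 mul0r.
    exact/at_closure_zero/oner_neq0.
  - move=> _ _ [r1 [s1 [s10 -> r1P]]] [r2 [s2 [s20 -> r2P]]].
    exists (r1 * s2 + r2 * s1), (s1 * s2); split; first exact: mulf_neq0.
      by rewrite addf_div ?tofrac_eq0 // tofracD !tofracM.
    exact: at_closure_add (ltW t0) ab b0 s10 s20 r1P r2P.
  - move=> q _ [r [s [s0 -> rP]]]; exists (q * r), s; split=> //.
      by rewrite tofracM mulrA.
    exact: at_closure_scale.
split=> // p /pcharf_prime/prime_gt1 p1 test0; split=> //.
have [c cP] : exists c, at_test_element p a t c.
  apply: contrapT => noc; apply: test0; rewrite /at_test_ideal.
  have -> : at_test_element p a t = set0; last exact: ideal_gen_set0.
  by apply/seteqP; split=> // c cP; apply: noc; exists c.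
have bP := mem_ideal_pow _ _ (ceil_mul t 1) _ ab.
exists (c * b ^+ ceil_mul t 1).
  by rewrite mulf_neq0 ?expf_neq0 //; case: cP.
move=> _ [r [s [s0 -> /(at_closure_tight _ _ _ _ p _ _ p1) rP]]].
have [z zE] := at_test_element_principal _ _ _ _ _ _ _ _ _ cP rP bP.
by exists z; rewrite mulrA -tofracM zE tofracM mulfK // tofrac_eq0.
Qed.
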